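(* Let $n\ge 2$ and $d\ge 2$ be integers, and let $\Upsilon$ be the Choi state of an $n$-step process tensor (as defined in the context). Then $$\mathrm{I}\le 2n\ln d-\frac{1}{2^n-2}\,\mathrm{N}.$$
   Context: An $n$-step process tensor with system dimension $d$ is represented by its Choi state $\Upsilon$, a density operator on $\mathcal{H}_{\mathrm{i}_0}\otimes\mathcal{H}_{\mathrm{o}_1}\otimes\cdots\otimes\mathcal{H}_{\mathrm{i}_{n-1}}\otimes\mathcal{H}_{\mathrm{o}_n}$ (each factor of dimension $d$) satisfying: for all $1\le j\le n$, $\mathrm{tr}_{\mathrm{o}_j}[\Upsilon_{1:j}]=\Upsilon_{1:j-1}\otimes\mathbb{I}_{\mathrm{i}_{j-1}}/d$, where $\Upsilon_{1:j}$ is the partial trace of $\Upsilon$ over $\mathrm{i}_j,\mathrm{o}_{j+1},\dots,\mathrm{i}_{n-1},\mathrm{o}_n$ (with $\Upsilon_{1:n}=\Upsilon$, $\Upsilon_{1:0}=1$). Entropies are von Neumann with natural log; $S_{\mathrm{i}_{j-1}},S_{\mathrm{o}_j}$ are single-factor marginal entropies of $\Upsilon$, $S_j$ the entropy of its marginal on $\mathrm{i}_{j-1}\mathrm{o}_j$, $S_{1:n}=S(\Upsilon)$. Total correlations: $\mathrm{I}=\sum_{j=1}^n(S_{\mathrm{i}_{j-1}}+S_{\mathrm{o}_j})-S_{1:n}$ (the multipartite mutual information among all $2n$ factors); non-Markovian correlations: $\mathrm{N}=\sum_{j=1}^n S_j-S_{1:n}$. *)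

(* Defs.v *)
From HB Require Import structures.
From mathcomp Require Import all_boot all_order all_algebra.
From mathcomp Require Import sesquilinear spectral.
From mathcomp Require Import reals exp.
From mathcomp Require Import complex.
Set Implicit Arguments. Unset Strict Implicit. Unset Printing Implicit Defensive.
Import Order.TTheory GRing.Theory Num.Theory.
Local Open Scope ring_scope.

(* Computational basis configurations of m qudits of dimension d:
   factor t (t < m) is in basis state x t. *)
Definition cfg (d m : nat) := {ffun 'I_m -> 'I_d}.

(* Operators on the m-qudit space, as matrices indexed by (enum_rank of) configurations. *)
Notation op R d m := 'M[R[i]]_#|cfg d m|.

Section Defs.
Variables (R : realType) (d m : nat).

Definition entry (M : op R d m) (x y : cfg d m) : R[i] := M (enum_rank x) (enum_rank y).

Definition psdmx (M : op R d m) : Prop :=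
  forall v : 'rV[R[i]]_#|cfg d m|, 0 <= (v *m M *m (v ^t* )%sesqui) 0 0.
Definition density (M : op R d m) : Prop :=
  [/\ M \is hermsymmx, psdmx M & \tr M = 1].

(* Partial trace over the factors outside S, with the kept factors S
   ordered increasingly (via enum_val) : the reduced density operator. *)
Definition restr (S : {set 'I_m}) (x : cfg d m) : cfg d #|S| :=
  [ffun t => x (enum_val t)].

Definition marg (S : {set 'I_m}) (M : op R d m) : op R d #|S| :=
  \matrix_(i, j)
    \sum_(x : cfg d m) \sum_(y : cfg d m |
       [&& restr S x == enum_val i, restr S y == enum_val j
         & [forall t, (t \notin S) ==> (x t == y t)]])
      entry M x y.

(* The same partial trace, read off at full configurations x, y (only their
   S-components matter): ptr S M x y = <x_S| tr_{~S} M |y_S>. *)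
Definition ptr (S : {set 'I_m}) (M : op R d m) (x y : cfg d m) : R[i] :=
  \sum_(x' : cfg d m) \sum_(y' : cfg d m |
     [forall t, if t \in S then (x' t == x t) && (y' t == y t) else x' t == y' t])
    entry M x' y'.
End Defs.

Definition xlnx (R : realType) (r : R) : R := r * ln r.
Definition vN_entropy (R : realType) (k : nat) (M : 'M[R[i]]_k) : R :=
  - \sum_(i < k) xlnx (@complex.Re R (spectral_diag M 0 i)).

Section PT.
Variables (R : realType) (n d : nat).
Local Notation Ups := (op R d n.*2).
(* factors are numbered 0..2n-1 : factor 2(j-1) is i_{j-1}, factor 2j-1 is o_j *)

(* process tensor condition: for every input factor l = i_{j-1} (even),
   tr_{o_j}[Ups_{1:j}] (marginal on factors t <= l)
   = Ups_{1:j-1} (marginal on factors t < l) \otimes I_{i_{j-1}} / d *)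
Definition process_tensor (U : Ups) : Prop :=
  (density U) /\ (forall l : 'I_(n.*2), ~~ odd l ->
    forall x y : cfg d n.*2,
      ptr [set t : 'I_(n.*2) | (t <= l)%N] U x y
      = ptr [set t : 'I_(n.*2) | (t < l)%N] U x y * (if x l == y l then (d%:R)^-1 else 0)).

Definition total_corr (U : Ups) : R :=
  \sum_(k < n.*2) vN_entropy (marg [set k] U) - vN_entropy U.

Definition nonmarkov_corr (U : Ups) : R :=
  \sum_(j < n) vN_entropy (marg [set t : 'I_(n.*2) | t./2 == j] U) - vN_entropy U.
End PT.

(* Main.v *)
(** Since every input factor is maximally mixed given the past, the Araki-Lieb
    inequality gives S_{1:j-1} + ln d = S(Ups_{1:j-1} (x) I/d) <= S_{1:j} + S_{o_j},
    so S_{1:j} is nondecreasing in j.  Araki-Lieb also gives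
    S_j <= S_{1:j} + S_{1:j-1}, whence sum_j S_j <= (2n - 1) S_{1:n} and
    N <= (2n - 2) S_{1:n} <= (2^n - 2) S_{1:n}.  Bounding each single-factor
    entropy by ln d turns this into the claim.

    Everything about spectra reduces to S(M M^* ) <= H(diag (M^* M)) for an
    arbitrary rectangular matrix M; applied to a purification written in a
    product basis, together with classical subadditivity, it yields
    Araki-Lieb. *)

Require Import Defs.
From HB Require Import structures.
From mathcomp Require Import all_boot all_order all_algebra.
From mathcomp Require Import sesquilinear spectral.
From mathcomp Require Import reals exp.
From mathcomp Require Import complex.
From mathcomp Require Import zify ring lra.
Set Implicit Arguments. Unset Strict Implicit. Unset Printing Implicit Defensive.
Import Order.TTheory GRing.Theory Num.Theory.
Local Open Scope ring_scope.

(** * Classical entropy inequalities *)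

Section Classical.
Variable R : realType.

(** This is [ln x <= x - 1] at [x = b / a], multiplied by [a]. Summed over two distributions it
    gives nonnegativity of relative entropy; every classical bound below uses it termwise. *)
Lemma gibbs (a b : R) : 0 <= a -> 0 <= b -> (0 < a -> 0 < b) ->
  a * (ln b - ln a) <= b - a.
Proof.
move=> a0 b0 ab; have [->|an0] := eqVneq a 0; first by rewrite mul0r subr0.
have apos : 0 < a by rewrite lt_def an0.
have bpos := ab apos; rewrite -ln_div ?posrE//.
have h : ln (b / a) <= b / a - 1.
  have -> : b / a = 1 + (b / a - 1) by ring.
  rewrite [leRHS](_ : _ = b / a - 1); last by ring.
  by apply: le_ln1Dx; rewrite ltrBrDr addrC subrr divr_gt0.
rewrite -(ler_pM2l apos) in h; apply: (le_trans h).
by rewrite mulrBr mulr1 mulrCA divff// mulr1.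
Qed.

(* A form of Schur's inequality: the column sums of n are the image of its row
   sums under a matrix whose rows sum to 1 and whose columns sum to at most 1. *)
Lemma substochastic_entropy (I K : finType) (n : I -> K -> R) :
  (forall i k, 0 <= n i k) ->
  (forall k, \sum_i n i k / (\sum_k' n i k') <= 1) ->
  \sum_k xlnx (\sum_i n i k) <= \sum_i xlnx (\sum_k n i k).
Proof.
move=> n0 bessel.
set q := fun k => \sum_i n i k; set l := fun i => \sum_k n i k.
have q0 k : 0 <= q k by apply: sumr_ge0.
have l0 i : 0 <= l i by apply: sumr_ge0.
rewrite -subr_le0.
have -> : \sum_k xlnx (q k) - \sum_i xlnx (l i)
   = \sum_i \sum_k n i k * (ln (q k) - ln (l i)).
  under [RHS]eq_bigr => i _.
    under eq_bigr => k _ do rewrite mulrBr.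
    rewrite sumrB -mulr_suml; over.
  rewrite sumrB exchange_big/=; congr (_ - _).
  by apply: eq_bigr => k _; rewrite -mulr_suml.
(* Gibbs with [b = q k * (n i k / l i)]. Summed over [i], the right side is at most [q k - q k = 0]
   by the bound on column sums. *)
have h i k : n i k * (ln (q k) - ln (l i)) <= q k * (n i k / l i) - n i k.
  have [->|nik] := eqVneq (n i k) 0; first by rewrite !mul0r mulr0 subr0.
  have npos : 0 < n i k by rewrite lt_def nik n0.
  have qpos : 0 < q k.
    by apply: (lt_le_trans npos); rewrite /q (bigD1 i)//= lerDl sumr_ge0.
  have lpos : 0 < l i.
    by apply: (lt_le_trans npos); rewrite /l (bigD1 k)//= lerDl sumr_ge0.
  have -> : ln (q k) - ln (l i) = ln (q k * (n i k / l i)) - ln (n i k).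
    rewrite lnM ?ln_div ?posrE// ?divr_gt0//; ring.
  apply: gibbs => // [|_]; first by apply: mulr_ge0 => //; apply: divr_ge0.
  by apply: mulr_gt0 => //; apply: divr_gt0.
apply: (@le_trans _ _ (\sum_i \sum_k (q k * (n i k / l i) - n i k))).
  by apply: ler_sum => i _; apply: ler_sum.
rewrite exchange_big/=; apply: sumr_le0 => k _.
rewrite sumrB -mulr_sumr subr_le0.
by rewrite -[leRHS]mulr1 ler_wpM2l.
Qed.

(** Relative entropy of [p] with respect to the product of its marginals, which also has total mass
    1. *)
Lemma entropy_subadditive (A B : finType) (p : A -> B -> R) :
  (forall a b, 0 <= p a b) -> \sum_a \sum_b p a b = 1 ->
  \sum_a xlnx (\sum_b p a b) + \sum_b xlnx (\sum_a p a b)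
    <= \sum_a \sum_b xlnx (p a b).
Proof.
move=> p0 p1.
set f := fun a => \sum_b p a b; set g := fun b => \sum_a p a b.
have f0 a : 0 <= f a by apply: sumr_ge0.
have g0 b : 0 <= g b by apply: sumr_ge0.
rewrite -subr_le0.
have -> : \sum_a xlnx (f a) + \sum_b xlnx (g b) - \sum_a \sum_b xlnx (p a b)
   = \sum_a \sum_b p a b * (ln (f a) + ln (g b) - ln (p a b)).
  under [RHS]eq_bigr => a _.
    under eq_bigr => b _ do rewrite mulrBr mulrDr.
    rewrite sumrB big_split/= -mulr_suml; over.
  rewrite sumrB big_split/= [in RHS]exchange_big/=; congr (_ + _ - _).
  by apply: eq_bigr => b _; rewrite -mulr_suml.
have h a b : p a b * (ln (f a) + ln (g b) - ln (p a b)) <= f a * g b - p a b.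
  have [->|nik] := eqVneq (p a b) 0; first by rewrite !mul0r subr0 mulr_ge0.
  have npos : 0 < p a b by rewrite lt_def nik p0.
  have qpos : 0 < f a.
    by apply: (lt_le_trans npos); rewrite /f (bigD1 b)//= lerDl sumr_ge0.
  have lpos : 0 < g b.
    by apply: (lt_le_trans npos); rewrite /g (bigD1 a)//= lerDl sumr_ge0.
  rewrite -lnM ?posrE//; apply: gibbs; rewrite ?mulr_ge0// => _; exact: mulr_gt0.
apply: (@le_trans _ _ (\sum_a \sum_b (f a * g b - p a b))).
  by apply: ler_sum => i _; apply: ler_sum.
under eq_bigr do rewrite sumrB -mulr_sumr.
rewrite sumrB -mulr_suml p1 mul1r /g exchange_big/= p1; lra.
Qed.

(** Relative entropy of [p] with respect to the uniform distribution; [K] is inhabited because an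
    empty sum cannot be 1. *)
Lemma entropy_le_ln_card (K : finType) (p : K -> R) :
  (forall k, 0 <= p k) -> \sum_k p k = 1 ->
  - \sum_k xlnx (p k) <= ln (#|K|%:R : R).
Proof.
move=> p0 p1.
have K0 : (0 < #|K|)%N.
  rewrite lt0n; apply/eqP => K0; move: p1.
  rewrite big1 => [/eqP|k]; first by rewrite eq_sym oner_eq0.
  by have := fintype0 k K0.
have KR : (0 : R) < #|K|%:R by rewrite ltr0n.
rewrite -subr_le0.
have -> : - \sum_k xlnx (p k) - ln #|K|%:R
   = \sum_k p k * (ln (#|K|%:R^-1) - ln (p k)).
  under [RHS]eq_bigr do rewrite mulrBr.
  rewrite sumrB -mulr_suml p1 mul1r lnV ?posrE//; rewrite /xlnx; lra.
apply: (@le_trans _ _ (\sum_k (#|K|%:R^-1 - p k))).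
  apply: ler_sum => k _; apply: gibbs => // [|_]; last by rewrite invr_gt0.
  by rewrite invr_ge0 ler0n.
by rewrite sumrB p1 sumr_const -(mulr_natr (_^-1)) mulVf ?lt0r_neq0// subrr.
Qed.

Lemma entropy_ge0 (K : finType) (p : K -> R) :
  (forall k, 0 <= p k) -> \sum_k p k = 1 -> 0 <= - \sum_k xlnx (p k).
Proof.
move=> p0 p1; rewrite oppr_ge0; apply: sumr_le0 => k _.
rewrite /xlnx mulr_ge0_le0//; apply: ln_le0.
by rewrite -p1 (bigD1 k)//= lerDl sumr_ge0.
Qed.
End Classical.

(** * Entropy of positive kernels on finite types *)

Section Kernels.
Variable R : realType.
Local Notation C := R[i].
Local Open Scope complex_scope.
Local Open Scope ring_scope.

(** The squared modulus as an element of [R] rather than of [R[i]], so that [xlnx] applies to it. *)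
Definition nsq (z : C) : R := complex.Re (z * z^*).

Lemma nsqE z : (nsq z)%:C = z * z^*.
Proof.
rewrite /nsq RRe_real// -normCK; apply: rpredX; exact: normr_real.
Qed.

Lemma nsq_ge0 z : 0 <= nsq z.
Proof. by rewrite -lecR nsqE mul_conjC_ge0. Qed.

Lemma conj_real (r : R) : (r%:C)^* = r%:C :> C.
Proof. by apply/CrealP; rewrite complex_real. Qed.

Lemma nsq_real (r : R) : nsq r%:C = r ^+ 2.
Proof. by apply: complexI; rewrite nsqE conj_real rmorphXn. Qed.

(** The vector [x] in the proof is the projection of the [k]-th basis vector onto the span of the
    orthogonal rows of [N]. Both its [k]-th coordinate and its squared norm equal [b], so
    [b ^+ 2 <= b]. *)
Lemma bessel (I K : finType) (N : I -> K -> C) (l : I -> R) :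
  (forall i j, \sum_k N i k * (N j k)^* = (i == j)%:R * (l i)%:C) ->
  forall k, \sum_i nsq (N i k) / l i <= 1.
Proof.
move=> ortho k; set b := \sum_i _.
pose x k' := \sum_i (N i k)^* * (l i)^-1%:C * N i k'.
have xk : x k = b%:C.
  rewrite /b rmorph_sum; apply: eq_bigr => i _.
  by rewrite /= rmorphM/= nsqE; ring.
have xx : \sum_k' nsq (x k') = b.
  apply: complexI; rewrite rmorph_sum /=.
  have xxE k' : (nsq (x k'))%:C = \sum_i \sum_j
      ((N i k)^* * (l i)^-1%:C) * (N j k * (l j)^-1%:C) * (N i k' * (N j k')^*).
    rewrite nsqE /x rmorph_sum mulr_suml; apply: eq_bigr => i _.
    rewrite mulr_sumr; apply: eq_bigr => j _.
    by rewrite !rmorphM/= conjCK conj_real; ring.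
  under eq_bigr do rewrite xxE.
  rewrite exchange_big /b rmorph_sum; apply: eq_bigr => i _ /=.
  rewrite exchange_big (bigD1 i)//= [X in _ + X]big1 ?addr0 => [|j ji].
    rewrite -mulr_sumr ortho eqxx mul1r rmorphM/= nsqE.
    have uE : (l i)^-1%:C * ((l i)^-1%:C * (l i)%:C) = (l i)^-1%:C.
      rewrite -!rmorphM/=; congr (_%:C).
      (* A zero row has [l i = 0] and contributes nothing, since the inverse of 0 is 0. *)
      by have [->|li] := eqVneq (l i) 0; rewrite ?invr0 ?mul0r// mulVf ?mulr1.
    by rewrite -[in RHS]uE; ring.
  by rewrite -mulr_sumr ortho eq_sym (negPf ji) mul0r mulr0.
have : b ^+ 2 <= b.
  rewrite -{2}xx -nsq_real -xk (bigD1 k)//= lerDl.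
  by apply: sumr_ge0 => ? _; apply: nsq_ge0.
have [//|b1] := leP b 1; nra.
Qed.

(** If [N N^*] is diagonal with entries [l], the diagonal of [N^* N] is more mixed than [l];
    Bessel's inequality is exactly the column condition of [substochastic_entropy]. *)
Lemma ortho_entropy (I K : finType) (N : I -> K -> C) (l : I -> R) :
  (forall i j, \sum_k N i k * (N j k)^* = (i == j)%:R * (l i)%:C) ->
  \sum_k xlnx (\sum_i nsq (N i k)) <= \sum_i xlnx (l i).
Proof.
move=> ortho.
have lE i : \sum_k nsq (N i k) = l i.
  apply: complexI; rewrite rmorph_sum/=; under eq_bigr do rewrite nsqE.
  by rewrite ortho eqxx mul1r.
under [leRHS]eq_bigr do rewrite -lE.
apply: substochastic_entropy => [i k|k]; first exact: nsq_ge0.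
under eq_bigr do rewrite lE; exact: bessel.
Qed.

(** * Von Neumann entropy bounded through Gram factorisations and spectral decompositions *)

Section Entropy.
Variable T : finType.
Implicit Type rho : T -> T -> C.

(** Indexing by an arbitrary finite type lets tensor products be plain product types, without
    arithmetic on matrix indices. *)
Definition entropy rho : R :=
  vN_entropy (\matrix_(i < #|T|, j < #|T|) rho (enum_val i) (enum_val j)).

(* Positivity, in the form that is visibly stable under partial traces. *)
Definition gram rho : Prop := exists (K : finType) (M : T -> K -> C),
  forall x y, rho x y = \sum_k M x k * (M y k)^*.

Definition state rho : Prop := gram rho /\ \sum_x rho x x = 1.

(** Orthonormality and completeness of the eigenvectors are both recorded, since later sums contract
    either the point or the eigenindex. The witness for [s] is read off [spectral_diag], so the
    entropy formula holds by definition. *)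
Lemma psd_spectral n (A : 'M[C]_n) : A \is hermsymmx ->
  (forall v : 'rV[C]_n, 0 <= (v *m A *m (v ^t* )%sesqui) 0 0) ->
  exists (s : 'I_n -> R) (w : 'I_n -> 'I_n -> C),
  [/\ forall k l, \sum_i w k i * (w l i)^* = (k == l)%:R,
      forall i j, \sum_k w k i * (w k j)^* = (i == j)%:R,
      forall i j, A i j = \sum_k (s k)%:C * w k i * (w k j)^*,
      forall k, 0 <= s k & vN_entropy A = - \sum_k xlnx (s k)].
Proof.
move=> /hermitian_normalmx/orthomx_spectralP Aeq psd.
have Pu := spectral_unitarymx A; rewrite invmx_unitary// in Aeq.
set P := spectralmx A in Aeq Pu; set D := spectral_diag A in Aeq.
have PP : P *m (P ^t* )%sesqui = 1%:M by apply/unitarymxP.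
have PP' : (P ^t* )%sesqui *m P = 1%:M by apply: mulmx1C.
(* Each eigenvalue is the quadratic form of [A] at a row of [P]. *)
have D0 k : 0 <= D 0 k.
  have -> : D 0 k = (P *m A *m (P ^t* )%sesqui) k k.
    by rewrite Aeq !mulmxA PP mul1mx -mulmxA PP mulmx1 mxE eqxx mulr1n.
  have := psd (row k P); rewrite -row_mul !mxE.
  by under eq_bigr do rewrite !mxE; under [X in _ -> _ <= X]eq_bigr do rewrite !mxE.
exists (fun k => complex.Re (D 0 k)), (fun k i => (P k i)^*); split.
- move=> k l; have /matrixP/(_ l k) := PP; rewrite !mxE eq_sym => <-.
  by apply: eq_bigr => i _; rewrite !mxE conjCK mulrC.
- move=> i j; have /matrixP/(_ i j) := PP'; rewrite !mxE => <-.
  by apply: eq_bigr => k _; rewrite !mxE conjCK.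
- move=> i j; rewrite {1}Aeq mul_mx_diag !mxE; apply: eq_bigr => k _.
  by rewrite !mxE conjCK RRe_real ?ger0_real// [_ * D 0 k]mulrC.
- by move=> k; rewrite -lecR RRe_real ?ger0_real.
- by [].
Qed.

Lemma gram_spectral rho : gram rho ->
  exists (s : 'I_#|T| -> R) (w : 'I_#|T| -> T -> C),
  [/\ forall k l, \sum_x w k x * (w l x)^* = (k == l)%:R,
      forall x y, \sum_k w k x * (w k y)^* = (x == y)%:R,
      forall x y, rho x y = \sum_k (s k)%:C * w k x * (w k y)^*,
      forall k, 0 <= s k & entropy rho = - \sum_k xlnx (s k)].
Proof.
move=> [K [M rhoE]]; rewrite /entropy; set A := (\matrix_(_, _) _).
have Aherm : A \is hermsymmx.
  apply/is_hermitianmxP; rewrite expr0 scale1r; apply/matrixP => i j.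
  rewrite !mxE !rhoE rmorph_sum; apply: eq_bigr => k _.
  by rewrite rmorphM/= conjCK mulrC.
have Apsd (v : 'rV[C]_#|T|) : 0 <= (v *m A *m (v ^t* )%sesqui) 0 0.
  have -> : (v *m A *m (v ^t* )%sesqui) 0 0
    = \sum_k (\sum_i v 0 i * M (enum_val i) k) * (\sum_i v 0 i * M (enum_val i) k)^*.
    rewrite mxE; under eq_bigr => j _.
      rewrite !mxE; under eq_bigr do rewrite mxE rhoE mulr_sumr.
      rewrite exchange_big mulr_suml; over.
    rewrite exchange_big; apply: eq_bigr => k _ /=.
    rewrite rmorph_sum mulr_sumr; apply: eq_bigr => j _.
    rewrite mulr_suml rmorphM/= mulr_suml; apply: eq_bigr => i _; ring.
  by apply: sumr_ge0 => k _; apply: mul_conjC_ge0.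
have [s [w [w1 w2 w3 s0 e]]] := psd_spectral Aherm Apsd.
exists s, (fun k x => w k (enum_rank x)); split => //.
- move=> k l; rewrite -w1 (reindex (fun i : 'I_#|T| => enum_val i))/=; last first.
    by exists enum_rank => x _; rewrite (enum_rankK, enum_valK).
  by apply: eq_bigr => i _; rewrite enum_valK.
- by move=> x y; rewrite w2 (inj_eq enum_rank_inj).
- by move=> x y; rewrite -w3 mxE !enum_rankK.
Qed.

(** Passing to an eigenbasis of [rho] multiplies [M] by a unitary on the left: the column norms of
    [M] do not change, while [M M^*] becomes diagonal with the spectrum of [rho], so [ortho_entropy]
    applies. *)
Lemma entropy_le_gram (K : finType) rho (M : T -> K -> C) :
  (forall x y, rho x y = \sum_k M x k * (M y k)^* ) ->
  entropy rho <= - \sum_k xlnx (\sum_x nsq (M x k)).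
Proof.
move=> rhoE; have [|s [w [w1 w2 w3 s0 ->]]] := @gram_spectral rho.
  by exists K, M.
rewrite lerN2.
(* N is M with its rows expressed in an eigenbasis of rho. *)
pose N i k := \sum_x (w i x)^* * M x k.
have qE k : \sum_x nsq (M x k) = \sum_i nsq (N i k).
  apply: complexI; rewrite !rmorph_sum/=.
  under [RHS]eq_bigr => i _.
    have -> : (nsq (N i k))%:C = \sum_x \sum_y
        M x k * (M y k)^* * (w i y * (w i x)^* ).
      rewrite nsqE rmorph_sum mulr_suml; apply: eq_bigr => x _.
      rewrite mulr_sumr; apply: eq_bigr => y _.
      by rewrite !rmorphM/= conjCK; ring.
    over.
  rewrite exchange_big; apply: eq_bigr => x _ /=.
  rewrite exchange_big (bigD1 x)//= -mulr_sumr w2 eqxx mulr1 nsqE.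
  rewrite big1 ?addr0// => y yx.
  by rewrite -mulr_sumr w2 (negPf yx) mulr0.
under eq_bigr do rewrite qE.
apply: ortho_entropy => i j.
transitivity (\sum_x \sum_y (w i x)^* * w j y * rho x y).
  under eq_bigr => k _.
    have -> : N i k * (N j k)^* = \sum_x \sum_y
        (w i x)^* * w j y * (M x k * (M y k)^* ).
      rewrite rmorph_sum mulr_suml; apply: eq_bigr => x _.
      rewrite mulr_sumr; apply: eq_bigr => y _.
      by rewrite !rmorphM/= conjCK; ring.
    over.
  rewrite exchange_big; apply: eq_bigr => x _ /=.
  rewrite exchange_big; apply: eq_bigr => y _ /=.
  by rewrite -mulr_sumr -rhoE.
transitivity (\sum_k (s k)%:C * (\sum_x w k x * (w i x)^* ) * (\sum_y w j y * (w k y)^* )).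
  under eq_bigr => x _.
    under eq_bigr do rewrite w3 mulr_sumr.
    rewrite exchange_big/=; over.
  rewrite exchange_big; apply: eq_bigr => k _ /=.
  rewrite -mulrA mulr_suml mulr_sumr; apply: eq_bigr => x _.
  by rewrite !mulr_sumr; apply: eq_bigr => y _; ring.
rewrite (bigD1 i)//= !w1 eqxx big1 => [|k ki].
  by rewrite addr0 mulr1 mulrC eq_sym.
by rewrite w1 (negPf ki) mulr0 mul0r.
Qed.

(* The v k need not span, so this also applies to a spectrum listed without
   some of its zeros. *)
Lemma entropy_ge_spectrum (K : finType) rho (l : K -> R) (v : K -> T -> C) :
  (forall k, 0 <= l k) ->
  (forall k j, \sum_x v k x * (v j x)^* = (k == j)%:R) ->
  (forall x y, rho x y = \sum_k (l k)%:C * v k x * (v k y)^* ) ->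
  - \sum_k xlnx (l k) <= entropy rho.
Proof.
move=> l0 v1 rhoE.
have sqE k : (Num.sqrt (l k))%:C * (Num.sqrt (l k))%:C = (l k)%:C :> C.
  by rewrite -rmorphM/= -expr2 sqr_sqrtr.
have [|s [w [w1 w2 w3 s0 ->]]] := @gram_spectral rho.
  exists K, (fun x k => (Num.sqrt (l k))%:C * v k x) => x y.
  rewrite rhoE; apply: eq_bigr => k _.
  by rewrite rmorphM/= conj_real -sqE; ring.
rewrite lerN2.
(* Weighted overlaps of the two families: the rows of [N] are orthogonal with squared norms [l], and
   its columns have squared norms [s]. *)
pose N k i := (Num.sqrt (l k))%:C * \sum_x v k x * (w i x)^*.
have sE i : s i = \sum_k nsq (N k i).
  apply: complexI; rewrite rmorph_sum/=.
  transitivity (\sum_x \sum_y (w i x)^* * w i y * rho x y).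
    transitivity (\sum_k (s k)%:C * (\sum_x w k x * (w i x)^* ) * (\sum_y w i y * (w k y)^* )).
      rewrite (bigD1 i)//= !w1 eqxx !mulr1 big1 ?addr0// => k ki.
      by rewrite w1 (negPf ki) mulr0 mul0r.
    under [RHS]eq_bigr => x _.
      under eq_bigr do rewrite w3 mulr_sumr.
      rewrite exchange_big/=; over.
    rewrite [RHS]exchange_big; apply: eq_bigr => k _ /=.
    rewrite -mulrA mulr_suml mulr_sumr; apply: eq_bigr => x _.
    by rewrite !mulr_sumr; apply: eq_bigr => y _; ring.
  under [LHS]eq_bigr => x _.
    under eq_bigr do rewrite rhoE mulr_sumr.
    rewrite exchange_big/=; over.
  rewrite exchange_big; apply: eq_bigr => k _ /=.
  rewrite nsqE /N rmorphM/= conj_real rmorph_sum mulrACA sqE mulr_suml mulr_sumr.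
  apply: eq_bigr => x _; rewrite mulr_sumr mulr_sumr; apply: eq_bigr => y _.
  by rewrite !rmorphM/= conjCK; ring.
under eq_bigr do rewrite sE.
apply: ortho_entropy => k j.
have -> : \sum_i N k i * (N j i)^* =
  (Num.sqrt (l k))%:C * (Num.sqrt (l j))%:C * \sum_x v k x * (v j x)^*.
  have NE i : N k i * (N j i)^* = \sum_x \sum_y
     (Num.sqrt (l k))%:C * (Num.sqrt (l j))%:C * (v k x * (v j y)^* )
      * (w i y * (w i x)^* ).
    rewrite /N rmorphM/= conj_real rmorph_sum mulrACA mulr_suml mulr_sumr.
    apply: eq_bigr => x _; rewrite mulr_sumr mulr_sumr; apply: eq_bigr => y _.
    by rewrite !rmorphM/= conjCK; ring.
  under eq_bigr do rewrite NE.
  rewrite exchange_big mulr_sumr; apply: eq_bigr => x _ /=.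
  rewrite exchange_big (bigD1 x)//= -mulr_sumr w2 eqxx mulr1.
  rewrite big1 ?addr0// => y yx.
  by rewrite -mulr_sumr w2 (negPf yx) mulr0.
rewrite v1; have [->|_] := eqVneq k j; last by rewrite mulr0 mul0r.
by rewrite mulr1 mul1r sqE.
Qed.

Lemma state_spectral rho : state rho ->
  exists (s : 'I_#|T| -> R) (w : 'I_#|T| -> T -> C),
  [/\ forall k l, \sum_x w k x * (w l x)^* = (k == l)%:R,
      forall x y, rho x y = \sum_k (s k)%:C * w k x * (w k y)^*,
      forall k, 0 <= s k, \sum_k s k = 1 & entropy rho = - \sum_k xlnx (s k)].
Proof.
move=> [/gram_spectral[s [w [w1 w2 w3 s0 e]]] tr].
exists s, w; split=> //; apply: complexI; rewrite rmorph_sum rmorph1 -tr /=.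
under [RHS]eq_bigr do rewrite w3.
rewrite exchange_big; apply: eq_bigr => k _ /=.
under eq_bigr do rewrite -mulrA.
by rewrite -mulr_sumr w1 eqxx mulr1.
Qed.

Lemma state_entropy_le rho : state rho -> entropy rho <= ln (#|T|%:R : R).
Proof.
move=> /state_spectral[s [w [_ _ s0 s1 ->]]].
by rewrite -[in leRHS](card_ord #|T|); apply: entropy_le_ln_card.
Qed.

Lemma state_entropy_ge0 rho : state rho -> 0 <= entropy rho.
Proof. by move=> /state_spectral[s [w [_ _ s0 s1 ->]]]; apply: entropy_ge0. Qed.
End Entropy.
End Kernels.

(** * Araki-Lieb inequality *)

Section States.
Variable R : realType.
Local Notation C := R[i].
Local Open Scope complex_scope.
Local Open Scope ring_scope.

Lemma mul_sum_conj (I J : finType) (f : I -> C) (g : J -> C) :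
  (\sum_i f i) * (\sum_j g j)^* = \sum_i \sum_j f i * (g j)^*.
Proof. by rewrite rmorph_sum big_distrlr. Qed.

Lemma eq_entropy (T : finType) (rho sigma : T -> T -> C) :
  rho =2 sigma -> entropy rho = entropy sigma.
Proof.
by move=> e; rewrite /entropy; congr vN_entropy; apply/matrixP => i j; rewrite !mxE e.
Qed.

Lemma eq_state (T : finType) (rho sigma : T -> T -> C) :
  rho =2 sigma -> state rho -> state sigma.
Proof.
move=> e [[K [M rhoE]] tr]; split; first by exists K, M => x y; rewrite -e.
by rewrite -tr; apply: eq_bigr => x _; rewrite e.
Qed.

(** * Invariance of entropy under relabelling of the basis *)

Section Reindex.
Variables (T T' : finType) (h : T' -> T).
Hypothesis hB : bijective h.

Lemma state_reindex (rho : T -> T -> C) : state rho -> state (fun x y => rho (h x) (h y)).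
Proof.
move=> [[K [M rhoE]] tr]; split; first by exists K, (fun x => M (h x)) => x y.
by rewrite -tr (reindex h)//; apply: onW_bij.
Qed.

(** Eigenvectors transported along [h] stay orthonormal, which bounds the new entropy from below
    without comparing the spectra chosen by [spectral_diag]. Applied to the inverse of [h] as well,
    this gives equality. *)
Lemma entropy_reindex_ge (rho : T -> T -> C) : state rho ->
  entropy rho <= entropy (fun x y => rho (h x) (h y)).
Proof.
move=> /state_spectral[s [w [w1 w3 s0 s1 ->]]].
apply: (@entropy_ge_spectrum _ _ _ _ s (fun k x => w k (h x))) => // k l.
by rewrite -w1 [RHS](reindex h)//; apply: onW_bij.
Qed.
End Reindex.

Lemma entropy_reindex (T T' : finType) (h : T' -> T) (rho : T -> T -> C) :
  bijective h -> state rho ->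
  entropy (fun x y => rho (h x) (h y)) = entropy rho.
Proof.
move=> hB rhoS; apply/eqP; rewrite eq_le entropy_reindex_ge// andbT.
have [g hK gK] := hB.
apply: (le_trans (@entropy_reindex_ge _ _ g _ _ (state_reindex hB rhoS))).
  by exists h.
by rewrite (@eq_entropy _ _ rho)// => x y; rewrite !gK.
Qed.

(** * Bipartite states: partial traces, Araki-Lieb, tensoring with a maximally mixed state *)

Section Bipartite.
Variables A B : finType.

(** The traced-out index joins the inner index of the Gram factorisation. *)
Lemma state_ptrace_r (rho : A * B -> A * B -> C) : state rho ->
  state (fun a a' => \sum_b rho (a, b) (a', b)).
Proof.
move=> [[K [M rhoE]] tr]; split.
  exists (B * K)%type, (fun a bk => M (a, bk.1) bk.2) => a a'.
  rewrite -(pair_bigA _ (fun b k => M (a, b) k * (M (a', b) k)^* ))/=.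
  by apply: eq_bigr => b _.
by rewrite -tr pair_bigA; apply: eq_bigr => -[].
Qed.

Lemma state_ptrace_l (rho : A * B -> A * B -> C) : state rho ->
  state (fun b b' => \sum_a rho (a, b) (a, b')).
Proof.
move=> [[K [M rhoE]] tr]; split.
  exists (A * K)%type, (fun b ak => M (ak.1, b) ak.2) => b b'.
  rewrite -(pair_bigA _ (fun a k => M (a, b) k * (M (a, b') k)^* ))/=.
  by apply: eq_bigr => a _.
by rewrite -tr exchange_big pair_bigA; apply: eq_bigr => -[].
Qed.

(** Purify [rho] and expand in the eigenbasis of its [B] marginal. The weights [p l k] form a joint
    distribution whose marginals are the spectra of the [B] marginal and of [rho]. The entropy on
    [A] is at most that of [p] by [entropy_le_gram], and subadditivity splits the latter. *)
Lemma araki_lieb (rho : A * B -> A * B -> C) : state rho ->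
  entropy (fun a a' => \sum_b rho (a, b) (a', b))
  <= entropy rho + entropy (fun b b' => \sum_a rho (a, b) (a, b')).
Proof.
move=> rhoS; have [rhoBG _] := state_ptrace_l rhoS.
have [t [u [u1 u2 u3 t0 ->]]] := gram_spectral rhoBG.
have [s [w [w1 w3 s0 s1 ->]]] := state_spectral rhoS.
have sqE k : (Num.sqrt (s k))%:C * (Num.sqrt (s k))%:C = (s k)%:C :> C.
  by rewrite -rmorphM/= -expr2 sqr_sqrtr.
(* The columns of M are the components, in the basis u of B and the eigenindex
   k of rho, of the purification sum_k sqrt (s k) |w k>|k>. *)
pose M a (lk : 'I_#|B| * 'I_#|{: A * B}|) :=
  (Num.sqrt (s lk.2))%:C * \sum_b w lk.2 (a, b) * (u lk.1 b)^*.
have ME a a' lk : M a lk * (M a' lk)^* = \sum_b \sum_b'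
   (s lk.2)%:C * w lk.2 (a, b) * (w lk.2 (a', b'))^* * (u lk.1 b' * (u lk.1 b)^* ).
  rewrite /M rmorphM/= conj_real mulrACA sqE mul_sum_conj mulr_sumr.
  apply: eq_bigr => b _; rewrite mulr_sumr; apply: eq_bigr => b' _.
  by rewrite rmorphM/= conjCK; ring.
pose p l k := \sum_a nsq (M a (l, k)).
have p0 l k : 0 <= p l k by apply: sumr_ge0 => a _; apply: nsq_ge0.
(* Summing out [k] leaves the diagonal element of the [B] marginal at its eigenvector [u l]. *)
have pt l : \sum_k p l k = t l.
  apply: complexI; rewrite rmorph_sum/=.
  have -> : (t l)%:C = \sum_b \sum_b' (\sum_a rho (a, b) (a, b')) * (u l b' * (u l b)^* ).
    transitivity (\sum_k (t k)%:C * (\sum_b u k b * (u l b)^* ) * (\sum_b' u l b' * (u k b')^* )).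
      rewrite (bigD1 l)//= !u1 eqxx !mulr1 big1 ?addr0// => k kl.
      by rewrite u1 (negPf kl) mulr0 mul0r.
    under [RHS]eq_bigr => b _.
      under eq_bigr do rewrite u3 mulr_suml.
      rewrite exchange_big/=; over.
    rewrite [RHS]exchange_big; apply: eq_bigr => k _ /=.
    rewrite -mulrA mulr_suml mulr_sumr; apply: eq_bigr => b _.
    by rewrite !mulr_sumr; apply: eq_bigr => b' _; ring.
  transitivity (\sum_k \sum_a \sum_b \sum_b'
    (s k)%:C * w k (a, b) * (w k (a, b'))^* * (u l b' * (u l b)^* )).
    apply: eq_bigr => k _; rewrite rmorph_sum; apply: eq_bigr => a _ /=.
    by rewrite nsqE ME.
  rewrite exchange_big/=.
  under [RHS]eq_bigr do (under eq_bigr do rewrite mulr_suml; rewrite exchange_big/=).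
  rewrite [RHS]exchange_big; apply: eq_bigr => a _ /=.
  rewrite exchange_big; apply: eq_bigr => b _ /=.
  rewrite exchange_big; apply: eq_bigr => b' _ /=.
  by rewrite w3 mulr_suml.
(* Completeness of [u] removes the basis of [B], leaving [s k] times the squared norm of [w k]. *)
have ps k : \sum_l p l k = s k.
  apply: complexI; rewrite rmorph_sum/=.
  transitivity (\sum_l \sum_a \sum_b \sum_b'
    (s k)%:C * w k (a, b) * (w k (a, b'))^* * (u l b' * (u l b)^* )).
    apply: eq_bigr => l _; rewrite rmorph_sum; apply: eq_bigr => a _ /=.
    by rewrite nsqE ME.
  transitivity (\sum_a \sum_b (s k)%:C * (w k (a, b) * (w k (a, b))^* )).
    rewrite exchange_big; apply: eq_bigr => a _ /=.
    rewrite exchange_big; apply: eq_bigr => b _ /=.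
    rewrite exchange_big (bigD1 b)//= -mulr_sumr u2 eqxx mulr1 big1 => [|b' bb'].
      by rewrite addr0 mulrA.
    by rewrite -mulr_sumr u2 (negPf bb') mulr0.
  rewrite pair_bigA -mulr_sumr/= -[RHS]mulr1; congr (_ * _).
  transitivity (\sum_x w k x * (w k x)^* ); first by apply: eq_bigr => -[].
  by rewrite w1 eqxx.
apply: (@le_trans _ _ (- \sum_lk xlnx (\sum_a nsq (M a lk)))).
  apply: entropy_le_gram => a a'.
  under [RHS]eq_bigr do rewrite ME.
  rewrite -(pair_bigA _ (fun l k => \sum_b \sum_b'
    (s k)%:C * w k (a, b) * (w k (a', b'))^* * (u l b' * (u l b)^* )))/=.
  under eq_bigr do rewrite w3.
  rewrite exchange_big [RHS]exchange_big; apply: eq_bigr => k _ /=.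
  rewrite [RHS]exchange_big; apply: eq_bigr => b _ /=.
  rewrite [RHS]exchange_big (bigD1 b)//= -mulr_sumr u2 eqxx mulr1 big1 => [|b' bb'].
    by rewrite addr0.
  by rewrite -mulr_sumr u2 (negPf bb') mulr0.
have := entropy_subadditive p0.
rewrite exchange_big/=; under eq_bigr do rewrite ps.
move=> /(_ s1).
under eq_bigr do rewrite pt.
under [X in _ + X]eq_bigr do rewrite ps.
rewrite (pair_bigA _ (fun l k => xlnx (p l k))) /=.
under [X in _ <= X -> _]eq_bigr => lk _ do rewrite /p -surjective_pairing.
by rewrite -opprD lerN2 [X in _ -> X <= _]addrC.
Qed.

(** The vectors [w k] tensored with the basis of [B] diagonalise [sigma], with eigenvalues
    [s k / #|B|]. *)
Lemma entropy_tensor_mixed (rho : A -> A -> C) (sigma : A * B -> A * B -> C) :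
  (0 < #|B|)%N -> state rho ->
  (forall x y, sigma x y
     = rho x.1 y.1 * (if x.2 == y.2 then (#|B|%:R)^-1 else 0)) ->
  entropy rho + ln (#|B|%:R : R) <= entropy sigma.
Proof.
move=> B0 /state_spectral[s [w [w1 w3 s0 s1 ->]]] sigmaE.
have BR : (0 : R) < #|B|%:R by rewrite ltr0n.
have BR0 := lt0r_neq0 BR.
pose l (kb : 'I_#|A| * B) := s kb.1 / #|B|%:R.
pose v (kb : 'I_#|A| * B) (x : A * B) : C := w kb.1 x.1 * (kb.2 == x.2)%:R.
have -> : - \sum_k xlnx (s k) + ln #|B|%:R = - \sum_kb xlnx (l kb).
  rewrite -(pair_bigA _ (fun k (b : B) => xlnx (s k / #|B|%:R)))/=.
  have e k : \sum_(b : B) xlnx (s k / #|B|%:R) = xlnx (s k) - s k * ln #|B|%:R.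
    rewrite sumr_const -(mulr_natr (xlnx _)) /xlnx mulrAC -mulrA mulrCA.
    have [->|sk0] := eqVneq (s k) 0; first by rewrite !mul0r mulr0 subr0.
    rewrite ln_div ?posrE// ?lt_def ?sk0// ?s0//.
    by field.
  under [in RHS]eq_bigr do rewrite e.
  by rewrite sumrB -mulr_suml s1 mul1r opprB addrC.
apply: (@entropy_ge_spectrum _ _ _ _ l v).
- by move=> kb; rewrite divr_ge0.
- move=> [k b] [j b']; rewrite /v /=.
  rewrite -(pair_bigA _ (fun a c => w k a * (b == c)%:R * (w j a * (b' == c)%:R)^* ))/=.
  have e a : \sum_c w k a * (b == c)%:R * (w j a * (b' == c)%:R)^*
     = w k a * (w j a)^* * (b == b')%:R.
    rewrite (bigD1 b)//= eqxx mulr1 big1 ?addr0 => [|c cb].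
      by rewrite rmorphM/= rmorph_nat mulrA eq_sym.
    by rewrite eq_sym (negPf cb) mulr0 mul0r.
  under eq_bigr do rewrite e.
  by rewrite -mulr_suml w1 xpair_eqE -natrM mulnb.
move=> [a b] [a' b']; rewrite sigmaE /v /l /=.
rewrite -(pair_bigA _ (fun k c => (s k / #|B|%:R)%:C * (w k a * (c == b)%:R)
  * (w k a' * (c == b')%:R)^* ))/= w3 mulr_suml.
apply: eq_bigr => k _; rewrite (bigD1 b)//= eqxx mulr1 big1 ?addr0 => [|c cb].
  rewrite !rmorphM/= rmorph_nat fmorphV/= rmorph_nat.
  by case: (b == b'); rewrite /=; ring.
by rewrite (negPf cb) mulr0 mulr0 mul0r.
Qed.
End Bipartite.
End States.

(** * Marginals of qudit operators *)

Section Marginals.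
Variables (R : realType) (d m : nat).
Hypothesis d0 : (0 < d)%N.
Local Notation C := R[i].
Implicit Types S : {set 'I_m}.

Lemma restr_eqP (S : {set 'I_m}) (x y : cfg d m) :
  reflect (forall t, t \in S -> x t = y t) (restr S x == restr S y).
Proof.
apply: (iffP eqP) => [/ffunP e t tS|e].
  by have := e (enum_rank_in tS t); rewrite !ffunE enum_rankK_in.
by apply/ffunP => i; rewrite !ffunE e ?enum_valP.
Qed.

(** A right inverse of [restr]; coordinates outside [S] get the arbitrary value 0, which exists by
    [d0]. *)
Definition extend (S : {set 'I_m}) (a : cfg d #|S|) : cfg d m :=
  [ffun t => if [pick i | enum_val i == t] is Some i then a i else Ordinal d0].

Arguments extend : clear implicits.

Lemma extendK S a : restr S (extend S a) = a.
Proof.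
apply/ffunP => i; rewrite !ffunE; case: pickP => [j /eqP/enum_val_inj->//|/(_ i)].
by rewrite eqxx.
Qed.

(** Going through a full configuration avoids locating the elements of [S1] and [S2] in the
    enumeration of [S]. Keeping [S] separate from [S1 :|: S2] avoids casts between dependent
    types. *)
Definition glue (S S1 S2 : {set 'I_m}) (ab : cfg d #|S1| * cfg d #|S2|) : cfg d #|S| :=
  restr S [ffun t => if t \in S1 then extend S1 ab.1 t else extend S2 ab.2 t].

Arguments glue : clear implicits.

Lemma restr_glueE S S1 S2 ab x : S = S1 :|: S2 -> [disjoint S1 & S2] ->
  (restr S x == glue S S1 S2 ab) = (restr S1 x == ab.1) && (restr S2 x == ab.2).
Proof.
move=> -> dis; rewrite -[in RHS](extendK ab.1) -[in RHS](extendK ab.2).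
apply/restr_eqP/andP => [e|[/restr_eqP e1 /restr_eqP e2] t].
  split; apply/restr_eqP => t tS.
    by rewrite e ?inE ?tS// ffunE tS.
  rewrite e ?inE ?tS ?orbT// ffunE; case: ifP => // tS1.
  by have := disjointFr dis tS1; rewrite tS.
rewrite inE ffunE; case: ifP => [tS1 _|_ /= tS2]; [exact: e1|exact: e2].
Qed.

Lemma glue_bij S S1 S2 : S = S1 :|: S2 -> [disjoint S1 & S2] ->
  bijective (glue S S1 S2).
Proof.
move=> SE dis; exists (fun c => (restr S1 (extend S c), restr S2 (extend S c))).
  move=> [a b]; set c := glue _ _ _ _.
  have := extendK c => /eqP; rewrite [in X in _ == X]/c restr_glueE//.
  by move=> /andP[/eqP-> /eqP->].
by move=> c; apply/esym/eqP; rewrite -{1}(extendK c) restr_glueE// !eqxx.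
Qed.

Section Operator.
Variable U : op R d m.

(* [marg] before its matrix indices are encoded by [enum_rank]. *)
Definition margk (S : {set 'I_m}) (a a' : cfg d #|S|) : C :=
  \sum_(x : cfg d m) \sum_(y : cfg d m |
       [&& restr S x == a, restr S y == a'
         & [forall t, (t \notin S) ==> (x t == y t)]])
    entry U x y.

Arguments margk : clear implicits.

Lemma margkE S : vN_entropy (marg S U) = entropy (margk S).
Proof. by []. Qed.

(** Links the form of partial trace used in [process_tensor] to the one whose entropy is taken. *)
Lemma ptr_margk S x y : ptr S U x y = margk S (restr S x) (restr S y).
Proof.
apply: eq_bigr => x' _; apply: eq_bigl => y'.
apply/forallP/and3P => [h|[/restr_eqP e1 /restr_eqP e2 /forallP h] t].
  split; [apply/restr_eqP => t tS | apply/restr_eqP => t tS | apply/forallP => t].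
  - by have := h t; rewrite tS => /andP[/eqP].
  - by have := h t; rewrite tS => /andP[_ /eqP].
  - by apply/implyP => tS; have := h t; rewrite (negPf tS).
case: ifP => [tS|/negbT tS]; first by rewrite e1// e2// !eqxx.
by have /implyP := h t; apply.
Qed.

(** Partial traces compose. The gluing map [g] is abstract so that either block can be traced
    out. *)
Lemma margk_tower S S1 S2 (g : cfg d #|S1| -> cfg d #|S2| -> cfg d #|S|) :
  S = S1 :|: S2 -> [disjoint S1 & S2] ->
  (forall x a b, (restr S x == g a b) = (restr S1 x == a) && (restr S2 x == b)) ->
  forall a a', \sum_b margk S (g a b) (g a' b) = margk S1 a a'.
Proof.
move=> SE dis gE a a'; rewrite exchange_big; apply: eq_bigr => x _ /=.
under eq_bigr do rewrite big_mkcond.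
rewrite exchange_big [RHS]big_mkcond; apply: eq_bigr => y _ /=.
under eq_bigr do rewrite !gE.
(* Only [b = restr S2 x] survives; what remains is that agreeing on [S2] and outside [S] means
   agreeing outside [S1]. *)
rewrite (bigD1 (restr S2 x))//= big1 ?addr0 => [|b bx]; last first.
  by rewrite [restr S2 x == b]eq_sym (negPf bx) andbF.
rewrite eqxx andbT; congr (if _ then _ else _); congr (_ && _).
rewrite -andbA; congr (_ && _).
apply/andP/forallP => [[/restr_eqP e /forallP h] t|h].
  apply/implyP => tS1; have [tS2|tS2] := boolP (t \in S2); first by rewrite e.
  by have /implyP := h t; apply; rewrite SE inE negb_or tS1.
split.
  apply/restr_eqP => t tS2; apply/eqP; rewrite eq_sym; have /implyP := h t; apply.
  by apply/negP => tS1; have := disjointFr dis tS1; rewrite tS2.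
apply/forallP => t; apply/implyP; rewrite SE inE negb_or => /andP[tS1 _].
by have /implyP := h t; apply.
Qed.

(** * Entropy inequalities for the marginals of a density operator *)

Hypothesis Ud : density U.

Lemma entry_state : state (entry U).
Proof.
have [Uherm Upsd Utr] := Ud; split.
  have [s [w [_ _ w3 s0 _]]] := psd_spectral Uherm Upsd.
  exists 'I_#|cfg d m|, (fun x k => (Num.sqrt (s k))%:C%C * w k (enum_rank x)) => x y.
  rewrite /entry w3; apply: eq_bigr => k _.
  by rewrite rmorphM/= conj_real -{1}(sqr_sqrtr (s0 k)) expr2 rmorphM/=; ring.
rewrite -Utr (reindex (fun i : 'I_#|cfg d m| => enum_val i))/=; last first.
  by exists enum_rank => x _; rewrite (enum_rankK, enum_valK).
by apply: eq_bigr => i _; rewrite /entry enum_valK.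
Qed.

Lemma extend_setT_bij : bijective (extend setT).
Proof.
exists (restr setT); first exact: extendK.
move=> x; apply/ffunP => t; have /eqP/restr_eqP := extendK (restr setT x).
by apply; rewrite inE.
Qed.

Lemma margk_setT a a' : margk setT a a' = entry U (extend setT a) (extend setT a').
Proof.
rewrite /margk (bigD1 (extend setT a))//= [X in _ + X]big1 ?addr0.
  rewrite (big_pred1 (extend setT a'))// => y.
  rewrite extendK eqxx /=; apply/andP/eqP => [[/eqP <- _]|->].
    apply/ffunP => t; have /eqP/restr_eqP := extendK (restr setT y).
    by move=> <-//; rewrite inE.
  by rewrite extendK eqxx; split=> //; apply/forallP => t; rewrite inE.
move=> x xa; rewrite big_pred0// => y; apply/negP => /andP[/eqP e _].
case/eqP: xa; rewrite -e; apply/ffunP => t.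
have /eqP/restr_eqP := extendK (restr setT x).
by move=> <-//; rewrite inE.
Qed.

Lemma margk_setT_state : state (margk setT).
Proof.
have := state_reindex extend_setT_bij entry_state.
by apply: eq_state => a b; rewrite margk_setT.
Qed.

(** The two operators agree only up to the bijection between [cfg d #|setT|] and [cfg d m], hence
    the appeal to [entropy_reindex]. *)
Lemma marg_entropy_setT : vN_entropy (marg setT U) = vN_entropy U.
Proof.
rewrite margkE.
rewrite (@eq_entropy _ _ _ (fun a b => entry U (extend setT a) (extend setT b))); last first.
  by move=> a b; rewrite margk_setT.
rewrite (entropy_reindex extend_setT_bij entry_state) /entropy.
congr vN_entropy; apply/matrixP => i j; by rewrite mxE /entry !enum_valK.
Qed.

Section Split.
Variables S S1 S2 : {set 'I_m}.
Hypotheses (SE : S = S1 :|: S2) (dis : [disjoint S1 & S2]).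

Lemma margk_tower_l a a' :
  \sum_b margk S (glue S S1 S2 (a, b)) (glue S S1 S2 (a', b)) = margk S1 a a'.
Proof.
apply: (margk_tower (g := fun a b => glue S S1 S2 (a, b))) => // x a1 b1.
by rewrite restr_glueE.
Qed.

Lemma margk_tower_r b b' :
  \sum_a margk S (glue S S1 S2 (a, b)) (glue S S1 S2 (a, b')) = margk S2 b b'.
Proof.
apply: (margk_tower (g := fun b a => glue S S1 S2 (a, b))).
- by rewrite setUC.
- by rewrite disjoint_sym.
by move=> x b1 a1; rewrite restr_glueE// andbC.
Qed.
End Split.

Lemma margk_state S : state (margk S).
Proof.
have SE : setT = S :|: ~: S by rewrite setUCr.
have dis : [disjoint S & ~: S] by rewrite -setI_eq0 setICr.
have := state_reindex (glue_bij SE dis) margk_setT_state.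
move=> /state_ptrace_r; apply: eq_state => a b.
by rewrite margk_tower_l.
Qed.

Lemma marg_entropy_ge0 S : 0 <= vN_entropy (marg S U).
Proof. exact: state_entropy_ge0 (margk_state S). Qed.

Lemma araki_lieb_marg S S1 S2 : S = S1 :|: S2 -> [disjoint S1 & S2] ->
  vN_entropy (marg S1 U) <= vN_entropy (marg S U) + vN_entropy (marg S2 U).
Proof.
rewrite !margkE.
move=> SE dis.
have gB := glue_bij SE dis.
have := araki_lieb (state_reindex gB (margk_state S)).
rewrite (entropy_reindex gB (margk_state S)).
rewrite (eq_entropy (margk_tower_l SE dis)).
by rewrite (eq_entropy (margk_tower_r SE dis)).
Qed.

Lemma card_cfg k : #|cfg d k| = (d ^ k)%N.
Proof. by rewrite card_ffun !card_ord. Qed.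

Lemma marg_entropy_le S : vN_entropy (marg S U) <= #|S|%:R * ln (d%:R : R).
Proof.
rewrite margkE; apply: (le_trans (state_entropy_le (margk_state S))).
by rewrite card_cfg natrX lnXn ?ltr0n// mulr_natl.
Qed.

Lemma marg_entropy_mixed S S1 l : S = S1 :|: [set l] -> l \notin S1 ->
  (forall x y : cfg d m, ptr S U x y = ptr S1 U x y * (if x l == y l then (d%:R)^-1 else 0)) ->
  vN_entropy (marg S1 U) + ln (d%:R : R) <= vN_entropy (marg S U).
Proof.
rewrite !margkE.
move=> SE lS1 mixed.
have dis : [disjoint S1 & [set l]] by rewrite disjoint_sym disjoints1.
have gB := glue_bij SE dis.
rewrite -(entropy_reindex gB (margk_state S)).
have cardl : #|cfg d #|[set l]| | = d by rewrite card_cfg cards1 expn1.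
rewrite -[X in ln X%:R]cardl.
apply: entropy_tensor_mixed; [by rewrite cardl | exact: margk_state |].
move=> p q; rewrite cardl.
(* The hypothesis on [ptr] speaks of full configurations, so the indices [p] and [q] are lifted to
   representatives. *)
have ex p' : exists x : cfg d m, restr S x = glue S S1 [set l] p'.
  by exists (extend S (glue S S1 [set l] p')); rewrite extendK.
have [x xp] := ex p; have [y yq] := ex q.
rewrite -xp -yq -ptr_margk mixed ptr_margk.
have /andP[/eqP-> /eqP<-] : (restr S1 x == p.1) && (restr [set l] x == p.2).
  by rewrite -(restr_glueE p x SE dis) xp.
have /andP[/eqP-> /eqP<-] : (restr S1 y == q.1) && (restr [set l] y == q.2).
  by rewrite -(restr_glueE q y SE dis) yq.
have -> // : (x l == y l) = (restr [set l] x == restr [set l] y).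
apply/eqP/restr_eqP => [e t|]; first by rewrite inE => /eqP->.
by apply; rewrite inE.
Qed.
End Operator.
End Marginals.

(** * Process tensors *)

Section Process.
Variables (R : realType) (n d : nat).
Hypotheses (d0 : (0 < d)%N) (n2 : (2 <= n)%N).
Variable U : op R d n.*2.
Hypothesis Upt : process_tensor U.

Let Ud : density U. Proof. by case: Upt. Qed.

(* [past_entropy j] is the S_{1:j} of the paper. *)
Definition past (j : nat) : {set 'I_n.*2} := [set t : 'I_n.*2 | (t < j.*2)%N].
Definition past_entropy (j : nat) : R := vN_entropy (marg (past j) U).

Let step (j : nat) : {set 'I_n.*2} := [set t : 'I_n.*2 | t./2 == j].

Lemma marg1_entropy_le k : vN_entropy (marg [set k] U) <= ln (d%:R : R).
Proof. by apply: (le_trans (marg_entropy_le d0 Ud _)); rewrite cards1 mul1r. Qed.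

Lemma past0 : past_entropy 0 <= 0.
Proof.
rewrite /past_entropy; apply: (le_trans (marg_entropy_le d0 Ud _)).
have -> : past 0 = set0 by apply/setP => t; rewrite !inE double0 ltn0.
by rewrite cards0 mul0r.
Qed.

Lemma past_ge0 j : 0 <= past_entropy j.
Proof. exact: marg_entropy_ge0. Qed.

Lemma past_last : past_entropy n = vN_entropy U.
Proof.
have e : past n = setT by apply/setP => t; rewrite !inE ltn_ord.
by rewrite /past_entropy e marg_entropy_setT.
Qed.

(** Araki-Lieb for [past j.+1] split into [step j] and [past j]. *)
Lemma step_entropy_le j : vN_entropy (marg (step j) U)
  <= past_entropy j.+1 + past_entropy j.
Proof.
apply: araki_lieb_marg => //.
  apply/setP => t; rewrite !inE; lia.
by apply/pred0P => t; rewrite !inE; lia.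
Qed.

(* The input of step j+1 is maximally mixed given the past, which raises the
   entropy by ln d; adjoining the output lowers it by at most ln d. *)
Lemma past_entropy_leS j : (j < n)%N -> past_entropy j <= past_entropy j.+1.
Proof.
move=> jn; have li : (j.*2 < n.*2)%N by lia.
have lo : (j.*2.+1 < n.*2)%N by lia.
pose i := Ordinal li; pose o := Ordinal lo.
(* The past together with the next input factor [i], but not yet the output [o]. *)
pose mid : {set 'I_n.*2} := [set t : 'I_n.*2 | (t <= i)%N].
have [_ /(_ i)] := Upt; rewrite /= odd_double => /(_ isT) mixed.
have h1 : past_entropy j + ln (d%:R : R) <= vN_entropy (marg mid U).
  apply: (@marg_entropy_mixed _ _ _ d0 _ Ud _ _ i) => //.
    by apply/setP => t; rewrite !inE -val_eqE /=; lia.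
  by rewrite inE /= ltnn.
have h2 : vN_entropy (marg mid U) <= past_entropy j.+1 + vN_entropy (marg [set o] U).
  apply: araki_lieb_marg => //.
    by apply/setP => t; rewrite !inE -val_eqE /=; lia.
  by rewrite disjoint_sym disjoints1 inE /= ltnn.
have := marg1_entropy_le o; lra.
Qed.

Lemma past_entropy_le j k : (j <= k <= n)%N -> past_entropy j <= past_entropy k.
Proof.
elim: k => [|k IH] /andP[jk kn]; first by have -> : j = 0%N by lia.
have [->//|jk'] := eqVneq j k.+1.
apply: le_trans (past_entropy_leS kn); apply: IH; lia.
Qed.

Lemma total_corr_le : total_corr U <= (n.*2)%:R * ln (d%:R : R) - vN_entropy U.
Proof.
rewrite /total_corr lerD2r.
apply: (@le_trans _ _ (\sum_(k < n.*2) ln (d%:R : R))); last first.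
  by rewrite sumr_const card_ord -[leLHS]mulr_natl.
by apply: ler_sum => k _; apply: marg1_entropy_le.
Qed.

Lemma nonmarkov_corr_le : nonmarkov_corr U <= (n.*2 - 2)%:R * vN_entropy U.
Proof.
have n0 : (0 < n)%N by lia.
have le2 (j : 'I_n) : vN_entropy (marg (step j) U) <= 2 * vN_entropy U.
  have jn := ltn_ord j.
  have h1 := @past_entropy_le j.+1 n; have h2 := @past_entropy_le j n.
  rewrite past_last leqnn andbT in h1; rewrite past_last leqnn andbT in h2.
  have := step_entropy_le j; have := h1 jn; have := h2 (ltnW jn); lra.
rewrite /nonmarkov_corr (bigD1 (Ordinal n0))//=.
(* The past of the first step is empty, which saves one copy of [vN_entropy U]. At [n = 2] the final
   comparison, [2n - 2 <= 2^n - 2], is an equality and has no room for that copy. *)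
have first : vN_entropy (marg (step 0) U) <= vN_entropy U.
  have h1 := @past_entropy_le 1 n; rewrite past_last leqnn andbT in h1.
  have := step_entropy_le 0; have := h1 n0; have := past0; lra.
have rest : \sum_(j < n | j != Ordinal n0) vN_entropy (marg (step j) U)
    <= n.-1%:R * (2 * vN_entropy U).
  apply: (@le_trans _ _ (\sum_(j < n | j != Ordinal n0) 2 * vN_entropy U)).
    by apply: ler_sum => j _; apply: le2.
  by rewrite sumr_const (cardC1 (Ordinal n0)) card_ord -[leLHS]mulr_natl.
have -> : (n.*2 - 2)%:R = n.-1%:R * 2 :> R by rewrite -natrM; congr _%:R; lia.
rewrite /step in first rest; lra.
Qed.
End Process.

Theorem mainTheorem5 (R : realType) (n d : nat) :
  (2 <= n)%N -> (2 <= d)%N ->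
  forall U : op R d n.*2, process_tensor U ->
  total_corr U <= (n.*2)%:R * ln (d%:R : R) - ((2%:R ^+ n - 2%:R)^-1) * nonmarkov_corr U.
Proof.
move=> n2 d2 U Upt; have d0 : (0 < d)%N by lia.
apply: (le_trans (total_corr_le d0 Upt)); rewrite lerD2l lerN2.
have S0 : 0 <= vN_entropy U by rewrite -past_last// past_ge0.
(* Doubling [n <= 2 ^ n.-1]. *)
have exp2 : (n.*2 <= 2 ^ n)%N.
  have : (n.-1 < 2 ^ n.-1)%N by apply: ltn_expl.
  by rewrite -[in (2 ^ n)%N](prednK (ltnW n2)) expnS; lia.
have E : 2%:R ^+ n - 2%:R = (2 ^ n - 2)%:R :> R by rewrite -natrX natrB//; lia.
rewrite E ler_pdivrMl; last by rewrite ltr0n; lia.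
apply: (le_trans (nonmarkov_corr_le d0 n2 Upt)).
by rewrite ler_wpM2r// ler_nat; lia.
Qed.
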